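(* For each $d\ge0$ let $\phi_d:\mathcal X\times\mathcal Y\to\mathbb R^d$ be measurable and let $\mathcal G_d$ be the sigma-field generated by the map $(x,y,y')\mapsto(\phi_d(x,y),\phi_d(x,y'))$ on $\mathcal X\times\mathcal Y^2$. Assume $\mathcal G_d\subseteq\mathcal G_{d+1}$ for every $d\ge0$. Define $$e_d=\mathbb E_{x\sim\nu}\mathbb E_{(y,y')\sim\mu_x^{\otimes2}}\bigl[(\bar p(x,y,y')-\tilde p_{\phi_d}(x,y,y'))^2\bigr].$$ Then $e_{d+1}\le e_d$ for all $d\ge0$.
   Context: $\mathcal X$ (prompts) and $\mathcal Y$ (responses) are measurable spaces, $\nu$ is a probability measure on $\mathcal X$, and for each $x$, $\mu_x$ is a probability measure on $\mathcal Y$ (a probability kernel in $x$). There are $n\ge1$ annotators with measurable utilities $u_i:\mathcal X\times\mathcal Y\to\mathbb R$. Let $F(t)=1/(1+e^{-t})$ and $\bar p(x,y,y')=\frac1n\sum_{i=1}^nF(u_i(x,y)-u_i(x,y'))$. $\tilde p_{\phi_d}(x,y,y')=\mathbb E_{(y_0,y_0')\sim\mu_x^{\otimes2}}[\bar p(x,y_0,y_0')\mid\phi_d(x,y_0)=\phi_d(x,y),\ \phi_d(x,y_0')=\phi_d(x,y')]$, i.e. for each $x$ the conditional expectation under $\mu_x^{\otimes2}$ given the pair of embedded values. *)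

(* Defs.v *)
From HB Require Import structures.
From mathcomp Require Import all_boot all_order all_algebra.
From mathcomp Require Import all_classical all_reals all_analysis.

Set Implicit Arguments.
Unset Strict Implicit.
Unset Printing Implicit Defensive.
Import Order.TTheory GRing.Theory Num.Theory.
Import numFieldNormedType.Exports.
Local Open Scope classical_set_scope.
Local Open Scope ring_scope.

Definition sigma_of (d : measure_display) (U : Type) (V : measurableType d)
    (f : U -> V) : set (set U) :=
  preimage_set_system setT f measurable.

(* g is a version of the conditional expectation of f under P given the
   sub-sigma-algebra G; as usual it is determined only P-almost surely. *)
Definition is_cond_exp (d : measure_display) (U : measurableType d)
    (R : realType) (P : {measure set U -> \bar R}) (G : set (set U)) (f g : U -> R) : Prop :=
  [/\ forall B : set R, measurable B -> G (g @^-1` B),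
      P.-integrable setT (EFin \o g) &
      forall A, G A ->
        (\int[P]_(z in A) (g z)%:E = \int[P]_(z in A) (f z)%:E)%E].

Section kernel_square.
Context {dX dY : measure_display} {X : measurableType dX}
  {Y : measurableType dY} {R : realType}.

(* The library does not equip k x with its probability structure, which the
   product measure needs (sigma-finiteness of the second factor). *)
Definition kernel_at (k : R.-pker X ~> Y) (x : X) : set Y -> \bar R := k x.

HB.instance Definition _ (k : R.-pker X ~> Y) (x : X) :=
  Measure.on (kernel_at k x).

HB.instance Definition _ (k : R.-pker X ~> Y) (x : X) :=
  Measure_isProbability.Build _ _ _ (kernel_at k x) (prob_kernel x).

Definition kernel_sqr (k : R.-pker X ~> Y) (x : X) :
    probability (Y * Y)%type R :=
  (kernel_at k x \x kernel_at k x)%E.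

End kernel_square.

Section preferences.
Context {dX dY : measure_display} {X : measurableType dX}
  {Y : measurableType dY} {R : realType}.

Definition logistic (t : R) : R := (1 + expR (- t))^-1.

Definition pbar (n : nat) (u : 'I_n -> X * Y -> R) (x : X) (z : Y * Y) : R :=
  n%:R^-1 * \sum_(i < n) logistic (u i (x, z.1) - u i (x, z.2)).

Definition embed_pair (d : nat) (phi : X * Y -> d.-tuple R)
    (w : X * (Y * Y)) : d.-tuple R * d.-tuple R :=
  (phi (w.1, w.2.1), phi (w.1, w.2.2)).

(* p is a version, for each x, of the conditional expectation of pbar u x under
   the square of mu_x given the pair of embedded values. *)
Definition is_ptilde (mu : R.-pker X ~> Y) (n : nat) (u : 'I_n -> X * Y -> R)
    (d : nat) (phi : X * Y -> d.-tuple R) (p : X -> Y * Y -> R) : Prop :=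
  forall x : X,
    is_cond_exp (kernel_sqr mu x) (sigma_of (fun z => embed_pair phi (x, z)))
      (pbar u x) (p x).

Definition sqr_error (nu : probability X R) (mu : R.-pker X ~> Y)
    (p q : X -> Y * Y -> R) : \bar R :=
  (\int[nu]_x \int[kernel_sqr mu x]_z ((p x z - q x z) ^+ 2)%:E)%E.

End preferences.

(* Main.v *)
(* For fixed x, refining the sigma-algebra can only decrease the L2 distance from
   pbar to its conditional expectation: with g, h the conditional expectations of f
   given G and H, where G is contained in H, the function h - g is H-measurable,
   hence orthogonal to f - h, and
   (f - g)^2 = (f - h)^2 + (h - g)^2 + 2 (h - g) (f - h).
   The versions g and h are arbitrary, so they are first clamped to the range of
   the bounded function f, which changes them only on a null set.  A sigma-algebra
   on X * Y^2 generated by an embedding induces on each section {x} * Y^2 the one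
   generated by the embedding at x, so the inclusion passes to the sections. *)
Require Import Defs.
From mathcomp Require Import all_boot all_order all_algebra.
From mathcomp Require Import all_classical all_reals all_analysis.
From mathcomp Require Import measurable_realfun ring lra.

Set Implicit Arguments.
Unset Strict Implicit.
Unset Printing Implicit Defensive.
Import Order.TTheory GRing.Theory Num.Theory.
Import numFieldNormedType.Exports.
Local Open Scope classical_set_scope.
Local Open Scope ring_scope.

(* A conditional expectation is chosen for each [x] separately, so the inner
   integral need not be measurable in [x] and [ge0_le_integral] does not apply. *)
Lemma ge0_le_integral_nonmeasurable (d : measure_display) (U : measurableType d)
    (R : realType) (m : {measure set U -> \bar R}) (f g : U -> \bar R) :
  (forall x, (0 <= f x)%E) -> (forall x, (f x <= g x)%E) ->
  (\int[m]_x f x <= \int[m]_x g x)%E.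
Proof.
move=> f0 fg; rewrite !ge0_integralTE//; last first.
  by move=> x; exact: le_trans (fg x).
apply: le_ereal_sup => _ [h hf <-]; exists h => // x.
exact: le_trans (hf x) (fg x).
Qed.

(** * Conditional expectations of bounded functions *)

Section cond_exp.
Context {d : measure_display} {U : measurableType d} {R : realType}.
Implicit Types (P : probability U R) (G H : set (set U)) (f g h q w : U -> R).

Lemma bounded_integrable P f (C : R) : measurable_fun setT f ->
  (forall z, `|f z| <= C) -> P.-integrable setT (EFin \o f).
Proof.
move=> mf fC; apply: measurable_bounded_integrable => //.
  by rewrite (le_lt_trans (probability_le1 P measurableT))// ltry.
by exists C; split; [exact: num_real|move=> M CM z _; exact: le_trans (ltW CM)].
Qed.

Lemma measurable_of_preimage G w : (forall A, G A -> measurable A) ->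
  (forall B, measurable B -> G (w @^-1` B)) -> measurable_fun setT w.
Proof. by move=> mG Gw _ B mB; rewrite setTI; apply/mG/Gw. Qed.

Lemma preimage_comp_measurable G w (k : R -> R) : measurable_fun setT k ->
  (forall B, measurable B -> G (w @^-1` B)) ->
  (forall B, measurable B -> G ((k \o w) @^-1` B)).
Proof.
move=> mk Gw B mB; rewrite comp_preimage; apply: Gw.
by rewrite -[X in measurable X]setTI; exact: mk.
Qed.

(** Orthogonality follows without simple functions: subtracting from [w] constants and multiples of
    indicators of sets in [G] does not change the integral, and [n] such steps bring the bound on
    [w] down to [C * 2^-n]. Only [w], not [q], is measurable with respect to [G]. *)
Lemma Rintegral_mul_eq0 P G q w (K C : R) :
  (forall A, G A -> measurable A) ->
  measurable_fun setT q -> (forall z, `|q z| <= K) ->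
  (forall A, G A -> \int[P]_(z in A) q z = 0) ->
  (forall B, measurable B -> G (w @^-1` B)) -> (forall z, `|w z| <= C) ->
  \int[P]_z (w z * q z) = 0.
Proof.
move=> mG mq qK q0 Gw wC.
(* A point of [U] is what turns the bounds on [|w|] and [|q|] into [0 <= C] and [0 <= K]; over an
   empty space the integral is trivially [0]. *)
have [z0|U0] := pselect (exists z : U, True); last first.
  rewrite (_ : [set: U] = set0) ?Rintegral_set0//.
  by apply/seteqP; split => // z _; apply: U0; exists z.
have {z0}[C0 K0] : 0 <= C /\ 0 <= K.
  by case: z0 => z _; split; [exact: le_trans (wC z)|exact: le_trans (qK z)].
(* Replacing [w] by [w - C/2] on [w >= 0] and by [w + C/2] elsewhere leaves the
   integral unchanged and halves the bound on [w]. *)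
have halving : forall (n : nat) (D : R) (v : U -> R), 0 <= D ->
    (forall B, measurable B -> G (v @^-1` B)) -> (forall z, `|v z| <= D) ->
    `|\int[P]_z (v z * q z)| <= D * K * 2^-1 ^+ n.
  elim=> [|m IH] D v D0 Gv vD.
    have mv := measurable_of_preimage mG Gv.
    have vqDK z : `|v z * q z| <= D * K by rewrite normrM ler_pM.
    have ivq : P.-integrable setT (EFin \o (fun z => v z * q z)).
      by apply: bounded_integrable vqDK; exact: measurable_funM.
    rewrite expr0 mulr1 (le_trans (le_normr_Rintegral _ ivq))//.
    have <- : \int[P]_z (D * K) = D * K.
      rewrite Rintegral_cst// -[RHS]mulr1; congr (_ * _).
      exact: (congr1 fine (probability_setT P)).
    apply: le_Rintegral => //; last exact: finite_measure_integrable_cst.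
    apply: (@bounded_integrable _ _ (D * K)) => [|z]; last by rewrite normr_id.
    by apply: measurableT_comp => //; exact: measurable_funM.
  pose k (t : R) := if 0 <= t then t - D / 2 else t + D / 2.
  have mk : measurable_fun setT k.
    apply: measurable_fun_ifT.
    - exact: measurable_fun_ler.
    - exact: measurable_funD.
    - exact: measurable_funD.
  have Gkv := preimage_comp_measurable mk Gv.
  have kvD z : `|(k \o v) z| <= D / 2.
    have := vD z; rewrite /= /k !ler_norml => /andP[v1 v2].
    by case: (leP 0 (v z)) => v0; apply/andP; split; lra.
  have D20 : 0 <= D / 2 by lra.
  have := IH _ _ D20 Gkv kvD.
  pose A := v @^-1` `[0, +oo[.
  have GA : G A by apply: Gv.
  have mA := mG _ GA.
  have iq : P.-integrable setT (EFin \o q) by exact: bounded_integrable qK.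
  have iqA : P.-integrable setT (EFin \o (q \_ A)).
    rewrite -restrict_EFin; apply: (integrable_mkcond _ mA).1.
    exact: (integrableS measurableT mA _ iq).
  have q0T : \int[P]_z q z = 0.
    by apply: q0; rewrite -(preimage_setT v); apply: Gv.
  have ikv : P.-integrable setT (EFin \o (fun z => (k \o v) z * q z)).
    apply: (@bounded_integrable _ _ (D / 2 * K)) => [|z].
      by apply: measurable_funM => //; exact: measurable_of_preimage Gkv.
    by rewrite normrM ler_pM.
  (* With [A] the event [0 <= v], one has [v = k \o v + D * 1_A - D / 2]. Both corrections integrate
     to [0] against [q], because [A] and the whole space belong to [G]. *)
  have -> : \int[P]_z (v z * q z) = \int[P]_z ((k \o v) z * q z).
    transitivity (\int[P]_z ((k \o v) z * q z + (D * (q \_ A) z - D / 2 * q z))).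
      apply: eq_Rintegral => z _.
      have zA : (z \in A) = (0 <= v z).
        by apply/idP/idP; rewrite inE /A/= in_itv/= andbT.
      by rewrite patchE /= /k zA; case: ifP => _; rewrite /point /=; field.
    have i1 : P.-integrable setT (EFin \o (fun z => D * (q \_ A) z)).
      exact: integrableZl iqA.
    have i2 : P.-integrable setT (EFin \o (fun z => D / 2 * q z)).
      exact: integrableZl iq.
    rewrite RintegralD//; last exact: integrableB i1 i2.
    rewrite (RintegralB _ i1 i2)// !RintegralZl//.
    by rewrite -Rintegral_mkcond q0// q0T !mulr0 subrr addr0.
  by rewrite exprS; lra.
have geo0 : geometric (C * K) (2^-1 : R) @ \oo --> (0 : R).
  by apply: cvg_geometric; rewrite ger0_norm ?invr_ge0// invf_lt1// ltr1n.
apply/eqP; rewrite -normr_le0 -(cvg_lim _ geo0)//.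
apply: limr_ge; first exact: cvgP geo0.
by near=> m; exact: halving.
Unshelve. all: by end_near. Qed.

(* Take [s = 1] or [s = -1] for the event that [g] exceeds the upper, resp. lower,
   bound of [f]. *)
Lemma cond_exp_sign_null P G f g (s C : R) A :
  (forall B, G B -> measurable B) -> measurable_fun setT f ->
  (forall z, `|f z| <= C) -> is_cond_exp P G f g -> G A ->
  (forall z, A z -> 0 < s * (g z - f z)) -> P A = 0%E.
Proof.
move=> mG mf fC [Gg ig gf] GA sA; have mA := mG _ GA.
have if_ : P.-integrable A (EFin \o f).
  by apply: integrableS (bounded_integrable P mf fC).
have {}ig : P.-integrable A (EFin \o g) by apply: integrableS ig.
have igf : P.-integrable A (EFin \o (fun z => g z - f z))
  by exact: (integrableB _ ig if_).
have isgf : P.-integrable A (EFin \o (fun z => s * (g z - f z))).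
  exact: integrableZl igf.
have : (\int[P]_(z in A) `|(s * (g z - f z))%:E| = 0)%E.
  rewrite (eq_integral (fun z => (s * (g z - f z))%:E)); last first.
    by move=> z /set_mem/sA sz; rewrite gee0_abs// lee_fin ltW.
  rewrite -[LHS]fineK ?integrable_fin_num//.
  rewrite -/(Rintegral P A (fun z => s * (g z - f z))) RintegralZl// RintegralB//.
  by rewrite /Rintegral gf// subrr mulr0.
(* So [s * (g - f)] vanishes almost everywhere on [A]; being positive at every point of [A], it
   forces [A] into the exceptional null set [N]. *)
move=> /(ae_eq_integral_abs P mA (measurable_int _ isgf))[N [mN PN0 AN]].
apply/eqP; rewrite -measure_le0 -PN0 le_measure ?inE// => z Az.
by apply: AN => /= /(_ Az)[] sz; have := sA _ Az; rewrite sz ltxx.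
Qed.

Definition clamp (C t : R) : R := Num.max (- C) (Num.min t C).

Lemma measurable_clamp C : measurable_fun setT (clamp C).
Proof. by apply: measurable_maxr => //; exact: measurable_minr. Qed.

Lemma clamp_le C t : 0 <= C -> `|clamp C t| <= C.
Proof.
by move=> C0; rewrite ler_norml /clamp /Num.max /Num.min; do ![case: ifP]; lra.
Qed.

(** Clamping moves [g] only on the events [C < g] and [g < - C]. Both lie in [G], and on each of
    them [g - f] has a strict constant sign, so both are null. *)
Lemma cond_exp_clamp P G f g (C : R) :
  (forall B, G B -> measurable B) -> measurable_fun setT f ->
  (forall z, `|f z| <= C) -> is_cond_exp P G f g ->
  ae_eq P setT g (clamp C \o g).
Proof.
move=> mG mf fC gf; have [Gg _ _] := gf.
have G1 : G (g @^-1` `]C, +oo[) by apply: Gg.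
have G2 : G (g @^-1` `]-oo, - C[) by apply: Gg.
have P1 : P (g @^-1` `]C, +oo[) = 0%E.
  apply: (cond_exp_sign_null (s := 1) mG mf fC gf G1) => z /=.
  by rewrite in_itv/= andbT; have := fC z; rewrite ler_norml; lra.
have P2 : P (g @^-1` `]-oo, - C[) = 0%E.
  apply: (cond_exp_sign_null (s := -1) mG mf fC gf G2) => z /=.
  by rewrite in_itv/=; have := fC z; rewrite ler_norml; lra.
have P12 : (P (g @^-1` `]C, +oo[) + P (g @^-1` `]-oo, (- C)%R[) <= 0)%E.
  by rewrite P1 P2 adde0.
exists (g @^-1` `]C, +oo[ `|` g @^-1` `]-oo, - C[); split.
- by apply: measurableU; exact: mG.
- apply/eqP; rewrite -measure_le0.
  exact: le_trans (measureU2 _ (mG _ G1) (mG _ G2)) P12.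
- move=> z /= /not_implyP[_ /eqP]; rewrite !in_itv/= andbT /clamp => gz.
  have [|gC] := ltP C (g z); first by left.
  right; rewrite ltNge; apply/negP => Cg; move: gz.
  by rewrite min_l// max_r// eqxx.
Qed.

Lemma cond_exp_sqr_le P G H f g h (C : R) :
  (forall A, H A -> measurable A) -> G `<=` H -> measurable_fun setT f ->
  (forall z, `|f z| <= C) -> is_cond_exp P G f g -> is_cond_exp P H f h ->
  (\int[P]_z ((f z - h z) ^+ 2)%:E <= \int[P]_z ((f z - g z) ^+ 2)%:E)%E.
Proof.
move=> mH GH mf fC gf hf.
have mG A : G A -> measurable A by move=> /GH/mH.
have [z0|U0] := pselect (exists z : U, True); last first.
  rewrite (_ : [set: U] = set0) ?integral_set0//.
  by apply/seteqP; split => // z _; apply: U0; exists z.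
have {z0}C0 : 0 <= C by case: z0 => z _; exact: le_trans (fC z).
have Gg : forall B : set R, measurable B -> H (g @^-1` B).
  by case: gf => + _ _ B mB => /(_ _ mB)/GH.
have [Hh ih hfE] := hf.
pose g' := clamp C \o g; pose h' := clamp C \o h.
have Hg' := preimage_comp_measurable (measurable_clamp C) Gg.
have Hh' := preimage_comp_measurable (measurable_clamp C) Hh.
have mg := measurable_of_preimage mH Gg.
have mh := measurable_of_preimage mH Hh.
have mg' := measurable_of_preimage mH Hg'.
have mh' := measurable_of_preimage mH Hh'.
have g'C z : `|g' z| <= C by exact: clamp_le.
have h'C z : `|h' z| <= C by exact: clamp_le.
have aeg := cond_exp_clamp mG mf fC gf.
have aeh := cond_exp_clamp mH mf fC hf.
have msqr (v : U -> R) : measurable_fun setT v ->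
    measurable_fun setT (fun z => ((f z - v z) ^+ 2)%:E).
  move=> mv; apply/measurable_EFinP; apply: measurable_funX.
  exact: measurable_funB.
(* The versions [g] and [h] are only known to be integrable, so their squared errors are compared in
   the extended reals until clamping makes them finite. *)
have clampE (v v' : U -> R) : measurable_fun setT v -> measurable_fun setT v' ->
    ae_eq P setT v v' ->
    (\int[P]_z ((f z - v z) ^+ 2)%:E = \int[P]_z ((f z - v' z) ^+ 2)%:E)%E.
  move=> mv mv' vv'; apply: ae_eq_integral => //; [exact: msqr|exact: msqr|].
  by apply: filterS vv' => z + _ => /(_ I) ->.
rewrite (clampE _ _ mg mg' aeg) (clampE _ _ mh mh' aeh).
pose q z := f z - h' z.
have mq : measurable_fun setT q by exact: measurable_funB.
have qC z : `|q z| <= C + C by rewrite (le_trans (ler_normB _ _))// lerD.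
(* The defining property belongs to [h]; it passes to [h'] by almost sure equality. *)
have q0 A : H A -> \int[P]_(z in A) q z = 0.
  move=> HA; have mA := mH _ HA.
  rewrite RintegralB//; last 2 first.
  - by apply: integrableS (bounded_integrable P mf fC).
  - by apply: integrableS (bounded_integrable P mh' h'C).
  apply/eqP; rewrite subr_eq0; apply/eqP; rewrite /Rintegral -hfE//; congr fine.
  apply: ae_eq_integral => //.
  - by apply/measurable_EFinP; exact: measurable_funTS.
  - by apply/measurable_EFinP; exact: measurable_funTS.
  - by apply: filterS aeh => z + _ => /(_ I) ->.
(* Here [G] contained in [H] matters: it makes [g'] as well as [h'] measurable for [H], so both are
   orthogonal to [q]. *)
have g'q0 := Rintegral_mul_eq0 mH mq qC q0 Hg' g'C.
have h'q0 := Rintegral_mul_eq0 mH mq qC q0 Hh' h'C.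
have ib (v : U -> R) (D : R) : measurable_fun setT v -> (forall z, `|v z| <= D) ->
    P.-integrable setT (EFin \o v) by exact: bounded_integrable.
have imul (v w : U -> R) (D E : R) :
    measurable_fun setT v -> measurable_fun setT w ->
    (forall z, `|v z| <= D) -> (forall z, `|w z| <= E) ->
    P.-integrable setT (EFin \o (fun z => v z * w z)).
  move=> mv mw vD wE; apply: (ib _ (D * E)); first exact: measurable_funM.
  by move=> z; rewrite normrM ler_pM.
have mfg' : measurable_fun setT (fun z => f z - g' z) by exact: measurable_funB.
have fg'C z : `|f z - g' z| <= C + C by rewrite (le_trans (ler_normB _ _))// lerD.
have ifg := imul _ _ _ _ mfg' mfg' fg'C fg'C.
have iqq := imul _ _ _ _ mq mq qC qC.
have ihq := imul _ _ _ _ mh' mq h'C qC.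
have igq := imul _ _ _ _ mg' mq g'C qC.
rewrite -[leLHS]fineK ?(integrable_fin_num _ iqq)//.
rewrite -[leRHS]fineK ?(integrable_fin_num _ ifg)// lee_fin.
have ihgq : P.-integrable setT (EFin \o (fun z => h' z * q z - g' z * q z)).
  exact: integrableB ihq igq.
have ihgq2 : P.-integrable setT
    (EFin \o (fun z => 2 * (h' z * q z - g' z * q z))).
  exact: integrableZl ihgq.
(* The added cross term has integral [0], and it makes the comparison pointwise: the new integrand
   differs from [(f - g')^2] by exactly [(h' - g')^2]. *)
have -> : fine (\int[P]_z ((f z - h' z) ^+ 2)%:E)%E =
    \int[P]_z (q z * q z + 2 * (h' z * q z - g' z * q z)).
  by rewrite RintegralD// RintegralZl// RintegralB// g'q0 h'q0 subrr mulr0 addr0.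
apply: le_Rintegral => //; first exact: integrableD iqq ihgq2.
move=> z _; rewrite -subr_ge0.
rewrite (_ : _ - _ = (h' z - g' z) ^+ 2) ?sqr_ge0// /q.
by rewrite -[(clamp C \o g) z]/(g' z); ring.
Qed.

End cond_exp.

(** * The mean preference and the sigma-algebras on sections *)

Section embedding.
Context {dX dY : measure_display} {X : measurableType dX}
  {Y : measurableType dY} {R : realType}.

Lemma logistic_ge0 (t : R) : 0 <= logistic t.
Proof. by rewrite invr_ge0 addr_ge0 ?expR_ge0. Qed.

Lemma logistic_le1 (t : R) : logistic t <= 1.
Proof. by rewrite invf_le1 ?lerDl ?expR_ge0// ltr_wpDr ?expR_ge0. Qed.

Lemma measurable_logistic : measurable_fun setT (@logistic R).
Proof.
apply: continuous_measurable_fun => t; apply: cvgV.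
  by rewrite gt_eqF// ltr_wpDr ?expR_ge0.
apply: cvgD; first exact: cvg_cst.
apply: (@continuous_comp _ _ _ -%R expR); first exact: opp_continuous.
exact: continuous_expR.
Qed.

Lemma pbar_norm_le1 (n : nat) (u : 'I_n -> X * Y -> R) x z :
  `|pbar u x z| <= 1.
Proof.
rewrite ger0_norm; last first.
  by rewrite mulr_ge0// sumr_ge0// => i _; exact: logistic_ge0.
(* For [n = 0] the convention [0^-1 = 0] gives the average the value [0]. *)
case: n u => [|n] u; first by rewrite /pbar invr0 mul0r.
rewrite /pbar mulrC ler_pdivrMr ?ltr0n// mul1r.
rewrite -[in leRHS](card_ord n.+1) -sumr_const ler_sum// => i _.
exact: logistic_le1.
Qed.

Lemma measurable_pbar (n : nat) (u : 'I_n -> X * Y -> R) x :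
  (forall i, measurable_fun setT (u i)) -> measurable_fun setT (pbar u x).
Proof.
move=> mu; apply: measurable_funM => //; apply: measurable_sum => i.
apply: measurableT_comp; first exact: measurable_logistic.
apply: measurable_funB; apply: measurableT_comp => //;
  exact: measurable_fun_pair.
Qed.

Lemma sigma_of_section_measurable (d : nat) (phi : X * Y -> d.-tuple R) x A :
  measurable_fun setT phi ->
  sigma_of (fun z => embed_pair phi (x, z)) A -> measurable A.
Proof.
move=> mphi [B mB <-].
have mpair : measurable_fun setT (fun z => embed_pair phi (x, z)).
  apply: measurable_fun_pair; apply: (measurableT_comp mphi) => /=;
    exact: measurable_fun_pair.
exact: mpair.
Qed.

(** A set [B'] whose preimage under [embed_pair psi] equals that of [B] under [embed_pair phi] on
    the whole product still does so after pulling back along [pair x]. *)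
Lemma sigma_of_section_sub (d e : nat) (phi : X * Y -> d.-tuple R)
    (psi : X * Y -> e.-tuple R) x :
  sigma_of (embed_pair phi) `<=` sigma_of (embed_pair psi) ->
  sigma_of (fun z => embed_pair phi (x, z)) `<=`
  sigma_of (fun z => embed_pair psi (x, z)).
Proof.
move=> sub _ [B mB <-].
have [|B' mB' BB'] := sub (setT `&` embed_pair phi @^-1` B); first by exists B.
exists B' => //; rewrite !setTI in BB' *.
by rewrite -[LHS]/(pair x @^-1` (embed_pair psi @^-1` B')) BB'.
Qed.

End embedding.

Theorem lemma4p1 (R : realType) (dX dY : measure_display)
    (X : measurableType dX) (Y : measurableType dY)
    (nu : probability X R) (mu : R.-pker X ~> Y)
    (n : nat) (hn : (1 <= n)%N)
    (u : 'I_n -> X * Y -> R) (hu : forall i, measurable_fun setT (u i))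
    (phi : forall d : nat, X * Y -> d.-tuple R)
    (hphi : forall d, measurable_fun setT (phi d))
    (hG : forall d,
      sigma_of (embed_pair (phi d)) `<=` sigma_of (embed_pair (phi d.+1)))
    (ptilde : forall d : nat, X -> Y * Y -> R)
    (hptilde : forall d, is_ptilde mu u (phi d) (ptilde d)) :
  forall d, (sqr_error nu mu (pbar u) (ptilde d.+1)
             <= sqr_error nu mu (pbar u) (ptilde d))%E.
Proof.
move=> d; apply: ge0_le_integral_nonmeasurable => x.
  by apply: integral_ge0 => z _; rewrite lee_fin sqr_ge0.
(* The constant [1] bounds [pbar], an average of logistic values in [[0, 1]]. *)
apply: (@cond_exp_sqr_le _ _ _ (kernel_sqr mu x) _ _ _ _ _ 1) (hptilde d x)
  (hptilde d.+1 x).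
- by move=> A; apply: sigma_of_section_measurable.
- exact: sigma_of_section_sub.
- exact: measurable_pbar.
- exact: pbar_norm_le1.
Qed.
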